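(* Let $M$ and $M'$ be $\mathcal C^\kappa$-smooth abstract CR-manifolds, let $d$ be the CR-codimension of $M$, let $M$ be of the type $\nu$ with $2\le\nu\le\kappa$, let $l\ge0$, $r:=2(d+1)l$, $k:=4(d^2+d)\nu l+4(d^2-1)l+2d\nu-2d+1$ and $\kappa\ge k+1$. Suppose that there exists a $\mathcal C^{\kappa-k-1}$-smooth section $\Phi\colon D^{r,l}(M,M')\to J^{r+1}(M,M')$ such that, for every open subset $U\subset M$ and every $0\le\widetilde l\le l$, every $\widetilde l$-nondegenerate $\mathcal C^k$-smooth CR-map $f\colon U\to M'$ satisfies $j_x^{r+1}f\equiv\Phi(x,j_x^rf)$, $x\in U$. Then any $l$-nondegenerate $\mathcal C^k$-smooth CR-map $f$ between open pieces of $M$ and $M'$ is necessarily of class $\mathcal C^{\kappa-k-1}$. In particular, if $M$ and $M'$ are $\mathcal C^\infty$, then $f$ is also $\mathcal C^\infty$.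
   Context: An (abstract) $\mathcal C^\kappa$-smooth CR-manifold ($\kappa\le\infty$) of CR-dimension $n$ and CR-codimension $d$ is a $\mathcal C^\kappa$-smooth real $(2n+d)$-dimensional manifold $M$ with a ($\mathcal C^{\kappa-1}$) subbundle $T^cM\subset TM$ of rank $2n$ and a bundle automorphism $J\colon T^cM\to T^cM$, $J^2=-\mathrm{id}$, such that the commutator of any two $(0,1)$ vector fields is again a $(0,1)$ vector field. Here $T^{1,0}M$ (resp. $T^{0,1}M$) is the bundle of all vectors $X-iJX$ (resp. $X+iJX$), $X\in T^cM$, and $(1,0)$ (resp. $(0,1)$) vector fields are its (local, class $\mathcal C^{\kappa-1}$) sections. A map $f\colon M\to M'$ is CR if $df(T^cM)\subset T^cM'$ and $df\circ J=J'\circ df$ on $T^cM$. $M$ is of finite type at $p$ if all $(1,0)$ and $(0,1)$ vector fields together with all their higher order commutators span $T_pM\otimes\mathbb C$; the minimal length $\nu\ge1$ of the commutators required is the type of $M$ at $p$, and the type of $M$ is the maximal type of $M$ at $p$ over all $p\in M$. If $\kappa=\infty$, then $\kappa-k-1=\infty$. Nondegenerate maps: on $M\times M'$ (product CR-structure) identify a vector field $L'$ on $M'$ with the vector field $(0,L')$ and a vector field $L$ on $M$ with the vector field $(L(x),f_*L(x))$ along the graph of $f$. A CR-map $f$ near $p$ with $f(p)=p'$ is $l$-nondegenerate at $p$ if for any $(0,1)$ vector field $L'$ on $M'$ with $L'(p')\ne0$ there are $(0,1)$ vector fields $L_1,\dots,L_k$ on $M$, $0\le k\le l$, and extensions $\widetilde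 L_1,\dots,\widetilde L_k$ of them from the graph of $f$ to $(0,1)$ vector fields on $M\times M'$ such that $[\widetilde L_1,\dots,[\widetilde L_k,\overline{L'}]\dots](p,p')\notin(T_pM\oplus T^c_{p'}M')\otimes\mathbb C$, and $l$ is the minimal number with this property (the degeneracy of $f$ at $p$). A CR-map $f$ on an open set $U$ is $l$-nondegenerate if $l$ is the maximum of its degeneracies at all $p\in U$. Jets: $J^k(M,M')$ is the bundle of $k$-jets of maps between open pieces of $M$ and $M'$; $(x,j_x^kf)$ denotes the element given by the $k$-jet of $f$ at $x$. A section $D^{r,l}(M,M')\to J^{r+1}(M,M')$ is a section over $D^{r,l}(M,M')$ of the natural projection $J^{r+1}(M,M')\to J^r(M,M')$. An $r$-jet at $p$ of a $\mathcal C^r$ map $f$ is a CR $r$-jet if $Lf=o(|x-p|^{r-1})$ as $x\to p$ for every $(0,1)$ vector field $L$ on $M$ near $p$ (i.e. the component of $f_*L(x)$ modulo $T^{0,1}M'$ is $o(|x-p|^{r-1})$). Let $l\le r$, $p'=f(p)$. If $M'$ is near $p'$ a generic submanifold of $\mathbb C^{N'}$ with local defining function $\rho'=(\rho'^1,\dots,\rho'^{d'})$, a CR $r$-jet at $p$ is $l$-nondegenerate if for a representative $f$ $$\mathrm{span}_{\mathbb C}\{L^\alpha\rho'^j_{Z'}(f,\overline f)(p):1\le j\le d',\ 0\le|\alpha|\le l\}=\mathbb C^{N'},$$ where $L_1,\dots,L_n$ is a basis of $(0,1)$ vector fields on $M$ near $p$, $L^\alpha=L_1^{\alpha_1}\cdots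 L_n^{\alpha_n}$ and $\rho'^j_{Z'}=(\partial\rho'^j/\partial Z'_1,\dots,\partial\rho'^j/\partial Z'_{N'})$ (this is independent of all choices). For general $M'$ the same definition is applied after replacing $M'$ by the image of an approximate embedding $\varphi$ of a neighborhood of $p'$ into $\mathbb C^{N'}$ ($N'$ = CR-dimension plus CR-codimension of $M'$), with generic image and $L'\varphi(y)=o(|y-p'|^{k'-1})$ for all $(0,1)$ vector fields $L'$ on $M'$ with $k'$ sufficiently large, and $f$ by $\varphi\circ f$. $D^{r,l}(M,M')\subset J^r(M,M')$ is the open subset of all $r$-jets that are either not CR or are CR and $\widetilde l$-nondegenerate for some $0\le\widetilde l\le l$. *)

(* Defs.v *)
From HB Require Import structures.
From mathcomp Require Import all_boot all_order all_algebra complex.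
From mathcomp Require Import all_classical all_reals all_analysis.
Set Implicit Arguments.
Unset Strict Implicit.
Unset Printing Implicit Defensive.
Import Order.TTheory GRing.Theory Num.Theory numFieldNormedType.Exports.
Local Open Scope classical_set_scope.
Local Open Scope ring_scope.
Local Open Scope complex_scope.

(** * Smoothness classes *)

Inductive smoothness := FinSmooth of nat | InfSmooth.

Definition smooth_ge (s : smoothness) (j : nat) : Prop :=
  if s is FinSmooth t then (j <= t)%N else True.

(* oo - j = oo *)
Definition smooth_sub (s : smoothness) (j : nat) : smoothness :=
  if s is FinSmooth t then FinSmooth (t - j)%N else InfSmooth.

(* C^s on A; only used with A open and V finite-dimensional. *)
Fixpoint Cn (R : realType) (V W : normedModType R) (s : nat)
    (A : set V) (F : V -> W) : Prop :=
  if s is t.+1 then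
    (forall x, A x -> differentiable F x) /\
    (forall v, Cn t A (fun x => 'D_v F x))
  else forall x, A x -> {for x, continuous F}.

Definition Csmooth (R : realType) (V W : normedModType R) (s : smoothness)
    (A : set V) (F : V -> W) : Prop :=
  if s is FinSmooth t then Cn t A F else forall t, Cn t A F.

(** * Complex-valued calculus on open subsets of R^m

   C^q is 'rV[R[i]]_q.  Differentiation is always with respect to real
   coordinates, hence on real and imaginary parts separately. *)

Section ComplexCalculus.
Context {R : realType}.

Definition reM p q (Z : 'M[R[i]]_(p, q)) : 'M[R]_(p, q) :=
  map_mx (@complex.Re R) Z.
Definition imM p q (Z : 'M[R[i]]_(p, q)) : 'M[R]_(p, q) :=
  map_mx (@complex.Im R) Z.
Definition cplxM p q (X Y : 'M[R]_(p, q)) : 'M[R[i]]_(p, q) :=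
  \matrix_(i, j) (X i j +i* Y i j).
Definition conjM p q (Z : 'M[R[i]]_(p, q)) : 'M[R[i]]_(p, q) :=
  map_mx conjc Z.

Definition CsmoothC m q (s : smoothness) (A : set 'rV[R]_m)
    (F : 'rV[R]_m -> 'rV[R[i]]_q) : Prop :=
  Csmooth s A (fun x => reM (F x)) /\ Csmooth s A (fun x => imM (F x)).

(* Derivative of F along Z = X + iY in C^m, extended C-linearly in Z. *)
Definition cderiv m q (F : 'rV[R]_m -> 'rV[R[i]]_q) (x : 'rV[R]_m)
    (Z : 'rV[R[i]]_m) : 'rV[R[i]]_q :=
  let F1 y := reM (F y) in let F2 y := imM (F y) in
  cplxM ('D_(reM Z) F1 x - 'D_(imM Z) F2 x)
        ('D_(reM Z) F2 x + 'D_(imM Z) F1 x).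

(* C-linear extension of the differential of a real map. *)
Definition cpush m q (F : 'rV[R]_m -> 'rV[R]_q) (x : 'rV[R]_m)
    (Z : 'rV[R[i]]_m) : 'rV[R[i]]_q :=
  cplxM ('D_(reM Z) F x) ('D_(imM Z) F x).

Definition vfield m := 'rV[R]_m -> 'rV[R[i]]_m.

Definition vact m q (L : vfield m) (F : 'rV[R]_m -> 'rV[R[i]]_q) :
  'rV[R]_m -> 'rV[R[i]]_q := fun x => cderiv F x (L x).

Definition bracket m (A B : vfield m) : vfield m :=
  fun x => cderiv B x (A x) - cderiv A x (B x).

Definition lspan (K : nzRingType) (V : lmodType K) (S : set V) : set V :=
  [set v | exists (q : nat) (a : 'I_q -> K) (w : 'I_q -> V),
     (forall i, S (w i)) /\ v = \sum_i a i *: w i].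

(* G(x) = o(|x - x0|^e) as x -> x0, for an integer exponent e. *)
Definition is_little_o m q (G : 'rV[R]_m -> 'rV[R[i]]_q) (x0 : 'rV[R]_m)
    (e : int) : Prop :=
  forall eps : R, 0 < eps ->
    \forall x \near x0,
      `|reM (G x)| + `|imM (G x)| <= eps * `|x - x0| ^ e.

Definition mindices (m r : nat) : {set {ffun 'I_m -> 'I_r.+1}} :=
  [set a : {ffun 'I_m -> 'I_r.+1} | (\sum_i (a i : nat) <= r)%N].

(* op_0^(a 0) o ... o op_(m-1)^(a (m-1)) *)
Definition mpower (T : Type) (m : nat) (op : 'I_m -> T -> T)
    (a : 'I_m -> nat) (F : T) : T :=
  foldr (fun i G => iter (a i) (op i) G) F (enum 'I_m).

Definition pderiv m q (i : 'I_m) (F : 'rV[R]_m -> 'rV[R]_q) :=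
  fun x => 'D_(delta_mx 0 i) F x.

(* All partial derivatives of F at x of order <= r, one per row. *)
Definition taylor m q (r : nat) (F : 'rV[R]_m -> 'rV[R]_q) (x : 'rV[R]_m) :
    'M[R]_(#|mindices m r|, q) :=
  \matrix_(i < #|mindices m r|)
    mpower (@pderiv m q) (fun b => enum_val i b : nat) F x.

End ComplexCalculus.

(** * Manifolds *)

Record chart (R : realType) (M : topologicalType) (m : nat) := Chart {
  cdom : set M;
  cmap :> M -> 'rV[R]_m;
  cinv : 'rV[R]_m -> M }.

Definition is_chart (R : realType) (M : topologicalType) (m : nat)
    (c : chart R M m) : Prop :=
  [/\ open (cdom c), open (c @` cdom c),
      forall x, cdom c x -> {for x, continuous c},
      forall y, (c @` cdom c) y -> {for y, continuous (cinv c)} &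
      forall x, cdom c x -> cinv c (c x) = x].

Record manifold (R : realType) (kappa : smoothness) (m : nat) := Manifold {
  carrier :> topologicalType;
  man_hausdorff : hausdorff_space carrier;
  man_countable : @second_countable carrier;
  atlas : set (chart R carrier m);
  atlas_chart : forall c, atlas c -> is_chart c;
  atlas_cover : forall x, exists2 c, atlas c & cdom c x;
  atlas_smooth : forall c1 c2, atlas c1 -> atlas c2 ->
    Csmooth kappa (c1 @` (cdom c1 `&` cdom c2)) (c2 \o cinv c1) }.

Definition chart_at (R : realType) (kappa : smoothness) (m : nat)
    (M : manifold R kappa m) (x : M) (c : chart R M m) : Prop :=
  atlas c /\ cdom c x.

(* V is an open neighborhood of c(x) inside the range of c. *)
Definition coord_nbhd (R : realType) (M : topologicalType) (m : nat)
    (c : chart R M m) (x : M) (V : set 'rV[R]_m) : Prop :=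
  [/\ open V, V (c x) & V `<=` c @` cdom c].

(** * CR-manifolds

   A tangent vector at x is given by its components in a chart c at x:
   [Tc c x v] says that the vector with components v lies in T^c_x M, and
   v *m Jc c x are the components of its image by J.  Only the restriction of
   the matrix Jc c x to T^c_x M is meaningful. *)

Definition cr01 (R : realType) (M : topologicalType) (m : nat)
    (Tc : chart R M m -> M -> set 'rV[R]_m) (Jc : chart R M m -> M -> 'M[R]_m)
    (c : chart R M m) (x : M) : set 'rV[R[i]]_m :=
  [set Z | exists2 v, Tc c x v & Z = cplxM v (v *m Jc c x)].

Definition cr10 (R : realType) (M : topologicalType) (m : nat)
    (Tc : chart R M m -> M -> set 'rV[R]_m) (Jc : chart R M m -> M -> 'M[R]_m)
    (c : chart R M m) (x : M) : set 'rV[R[i]]_m :=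
  [set Z | exists2 v, Tc c x v & Z = cplxM v (- (v *m Jc c x))].

(* X is a C^s local section, over V, of the field of subsets B of C^m. *)
Definition field_in (R : realType) (M : topologicalType) (m : nat)
    (s : smoothness) (c : chart R M m) (B : M -> set 'rV[R[i]]_m)
    (V : set 'rV[R]_m) (X : vfield m) : Prop :=
  CsmoothC s V X /\ forall y, V y -> B (cinv c y) (X y).

Record cr_manifold (R : realType) (kappa : smoothness) (n d : nat) :=
  CRManifold {
  cr_man :> manifold R kappa (2 * n + d);
  Tc : chart R cr_man (2 * n + d) -> cr_man -> set 'rV[R]_(2 * n + d);
  Jc : chart R cr_man (2 * n + d) -> cr_man -> 'M[R]_(2 * n + d);
  (* invariance under changes of charts *)
  Tc_change : forall x c1 c2, chart_at x c1 -> chart_at x c2 ->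
    forall v, Tc c1 x v ->
      let D w := 'D_w (c2 \o cinv c1) (c1 x) in
      Tc c2 x (D v) /\ D (v *m Jc c1 x) = D v *m Jc c2 x;
  (* T^cM is a C^(kappa-1) subbundle of rank 2n with C^(kappa-1) J:
     the rows of X y form a local frame *)
  Tc_frame : forall x c, chart_at x c ->
    exists (V : set 'rV[R]_(2 * n + d))
           (X : 'rV[R]_(2 * n + d) -> 'M[R]_(2 * n, 2 * n + d)),
      [/\ coord_nbhd c x V,
          Csmooth (smooth_sub kappa 1) V X,
          Csmooth (smooth_sub kappa 1) V (fun y => X y *m Jc c (cinv c y)),
          forall y, V y -> row_free (X y) &
          forall y, V y -> forall v,
            Tc c (cinv c y) v <-> (v <= X y)%MS];
  Jc_stable : forall x c, chart_at x c -> forall v, Tc c x v ->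
    Tc c x (v *m Jc c x) /\ v *m Jc c x *m Jc c x = - v;
  cr_integrable : forall x c, chart_at x c -> forall V, coord_nbhd c x V ->
    forall A B,
      field_in (smooth_sub kappa 1) c (cr01 Tc Jc c) V A ->
      field_in (smooth_sub kappa 1) c (cr01 Tc Jc c) V B ->
      forall y, V y -> cr01 Tc Jc c (cinv c y) (bracket A B y) }.

Section CR.
Context {R : realType} {kappa : smoothness}.

Section OneManifold.
Context {n d : nat} (M : cr_manifold R kappa n d).
Local Notation m := (2 * n + d)%N.
Implicit Types (c : chart R M m) (x : M) (V : set 'rV[R]_m).

Definition T01 c x : set 'rV[R[i]]_m := cr01 (@Tc _ _ _ _ M) (@Jc _ _ _ _ M) c x.
Definition T10 c x : set 'rV[R[i]]_m := cr10 (@Tc _ _ _ _ M) (@Jc _ _ _ _ M) c x.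

Definition field01 c V (L : vfield m) : Prop :=
  field_in (smooth_sub kappa 1) c (T01 c) V L.
Definition field10 c V (L : vfield m) : Prop :=
  field_in (smooth_sub kappa 1) c (T10 c) V L.

(* Commutators of (1,0) and (0,1) vector fields over V, indexed by length:
   the fields themselves have length 1. *)
Inductive commutator c V : nat -> vfield m -> Prop :=
| Comm1 L : field10 c V L \/ field01 c V L -> commutator c V 1 L
| CommS a b A B : commutator c V a A -> commutator c V b B ->
    commutator c V (a + b) (bracket A B).

Definition comm_span (j : nat) x : Prop :=
  forall c, chart_at x c ->
    lspan [set Z | exists V a A,
      [/\ coord_nbhd c x V, (a <= j)%N, commutator c V a A & Z = A (c x)]]
    = setT.

Definition type_at x (nu : nat) : Prop :=
  [/\ (1 <= nu)%N, comm_span nu x &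
      forall j, (1 <= j < nu)%N -> ~ comm_span j x].

Definition cr_type (nu : nat) : Prop :=
  (forall x : M, exists2 j, (j <= nu)%N & type_at x j) /\
  (exists x : M, type_at x nu).

Definition basis01 c V (L : 'I_n -> vfield m) : Prop :=
  [/\ forall i, field01 c V (L i),
      forall y, V y -> row_free (\matrix_i L i y) &
      forall y, V y -> forall Z, T01 c (cinv c y) Z ->
        (Z <= \matrix_i L i y)%MS].

(** ** Approximate embeddings into C^N, N = n + d

   C^N is R^(N + N) via Z = X + iY <-> (X, Y). *)

Definition toC N (z : 'rV[R]_(N + N)) : 'rV[R[i]]_N :=
  cplxM (lsubmx z) (rsubmx z).

(* (d rho^j / dZ_1, ..., d rho^j / dZ_N),
   where d/dZ_a = 1/2 (d/dX_a - i d/dY_a) *)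
Definition rhoZ N e (rho : 'rV[R]_(N + N) -> 'rV[R]_e) (j : 'I_e)
    (z : 'rV[R]_(N + N)) : 'rV[R[i]]_N :=
  \row_a (('D_(delta_mx 0 (lshift N a)) rho z 0 j / 2%:R) +i*
          (- ('D_(delta_mx 0 (rshift N a)) rho z 0 j / 2%:R))).

(* phi, read in the chart c, embeds a neighborhood V of y0 onto the generic
   submanifold {rho = 0} of an open set W of C^N (generic: the rho^j_Z are
   C-linearly independent), and L phi = o(|y - y0|^(k-1)) for all (0,1) vector
   fields L near y0.  An injective immersion onto {rho = 0} is an embedding,
   since both sides have real dimension 2n + d. *)
Definition approx_embedding (k : nat) c (y0 : M)
    (phi : 'rV[R]_m -> 'rV[R]_((n + d) + (n + d)))
    (rho : 'rV[R]_((n + d) + (n + d)) -> 'rV[R]_d) : Prop :=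
  (exists V W, [/\ coord_nbhd c y0 V, open W,
     [/\ Csmooth kappa V phi, {in V &, injective phi} &
         forall y, V y -> forall v, 'D_v phi y = 0 -> v = 0],
     Csmooth kappa W rho /\
       (forall z, W z -> row_free (\matrix_j rhoZ rho j z)) &
     phi @` V = W `&` [set z | rho z = 0]]) /\
  (forall V L, coord_nbhd c y0 V -> field01 c V L ->
     is_little_o (vact L (fun y => toC (phi y))) (c y0) (k%:Z - 1)).

End OneManifold.

(** * Maps *)

Section Maps.
Context {n d n' d' : nat}.
Variables (M : cr_manifold R kappa n d) (M' : cr_manifold R kappa n' d').
Local Notation m := (2 * n + d)%N.
Local Notation m' := (2 * n' + d')%N.
Implicit Types (f g : M -> M') (U : set M) (x p : M).

Definition local_rep (c : chart R M m) (c' : chart R M' m') f :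
  'rV[R]_m -> 'rV[R]_m' := c' \o f \o cinv c.

(* A map U -> M' is the restriction to the open set U of a total map f. *)
Definition smooth_on (s : smoothness) U f : Prop :=
  (forall x, U x -> {for x, continuous f}) /\
  forall c c', atlas c -> atlas c' ->
    Csmooth s (c @` (U `&` cdom c `&` f @^-1` cdom c')) (local_rep c c' f).

Definition smooth_near (s : smoothness) x f : Prop :=
  exists U, [/\ open U, U x & smooth_on s U f].

Definition CR_on U f : Prop :=
  forall x, U x -> forall c c', chart_at x c -> chart_at (f x) c' ->
    forall v, Tc c x v ->
      let df w := 'D_w (local_rep c c' f) (c x) in
      Tc c' (f x) (df v) /\ df (v *m Jc c x) = df v *m Jc c' (f x).

(** ** Nondegenerate maps *)

(* A (0,1) vector field of class C^s for the product CR-structure on M x M'. *)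
Definition prod_field01 (s : smoothness) (c : chart R M m) (c' : chart R M' m')
    (W : set 'rV[R]_(m + m')) (X : vfield (m + m')) : Prop :=
  CsmoothC s W X /\
  forall z, W z -> T01 c (cinv c (lsubmx z)) (lsubmx (X z)) /\
                   T01 c' (cinv c' (rsubmx z)) (rsubmx (X z)).

(* The field (0, conj L') on M x M'. *)
Definition lift_conj (L' : @vfield R m') : vfield (m + m') :=
  fun z => row_mx 0 (conjM (L' (rsubmx z))).

Definition iter_bracket q (X : 'I_q -> @vfield R (m + m')) (B : vfield (m + m')) :
  vfield (m + m') := foldr (fun i Y => bracket (X i) Y) B (enum 'I_q).

(* The property defining l-nondegeneracy at p, without the minimality of l,
   for f of class C^s near p.  The field (L, f_*L) along the graph of f is only
   of class C^(s-1), hence so are its extensions. *)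
Definition nondeg_upto (s l : nat) f p : Prop :=
  forall c c', chart_at p c -> chart_at (f p) c' ->
  forall (V' : set 'rV[R]_m') (L' : vfield m'),
    coord_nbhd c' (f p) V' -> field01 c' V' L' -> L' (c' (f p)) != 0 ->
  exists q (V : set 'rV[R]_m) (W : set 'rV[R]_(m + m'))
         (L : 'I_q -> vfield m) (X : 'I_q -> vfield (m + m')),
    [/\ (q <= l)%N /\ coord_nbhd c p V,
        [/\ open W, W (row_mx (c p) (c' (f p))) &
            forall z, W z -> V (lsubmx z) /\ V' (rsubmx z)],
        forall i, field01 c V (L i),
        forall i, prod_field01 (FinSmooth s.-1) c c' W (X i) /\
          forall y, let F := local_rep c c' f in
            W (row_mx y (F y)) ->
            X i (row_mx y (F y)) = row_mx (L i y) (cpush F y (L i y)) &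
        let Z := rsubmx (iter_bracket X (lift_conj L')
                           (row_mx (c p) (c' (f p)))) in
        ~ (Tc c' (f p) (reM Z) /\ Tc c' (f p) (imM Z))].

Definition degeneracy (s : nat) f p (l : nat) : Prop :=
  nondeg_upto s l f p /\ forall j, (j < l)%N -> ~ nondeg_upto s j f p.

Definition nondegenerate_on (s l : nat) U f : Prop :=
  (forall p, U p -> exists2 j, (j <= l)%N & degeneracy s f p j) /\
  (exists2 p, U p & degeneracy s f p l).

(** ** Jets

   A jet at x is the pair of x and the set of all maps representing it. *)

Definition jet : Type := (M * set (M -> M'))%type.

Definition jet_coord (r : nat) (c : chart R M m) (c' : chart R M' m')
    x f :=
  taylor r (local_rep c c' f) (c x).

Definition same_jet (r : nat) x f g : Prop :=
  f x = g x /\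
  forall c c', chart_at x c -> chart_at (f x) c' ->
    jet_coord r c c' x f = jet_coord r c c' x g.

Definition jet_of (r : nat) x f : jet :=
  (x, [set g | smooth_near (FinSmooth r) x g /\ same_jet r x f g]).

Definition is_jet (r : nat) (j : jet) : Prop :=
  exists2 f, smooth_near (FinSmooth r) j.1 f & j = jet_of r j.1 f.

(* f_*L is o(|x-p|^(r-1)) modulo T^{0,1}M': W x is the T^{0,1}M'-component. *)
Definition CR_jet (r : nat) (j : jet) : Prop :=
  let p := j.1 in
  exists2 f, j.2 f &
  forall c c', chart_at p c -> chart_at (f p) c' ->
  forall V L, coord_nbhd c p V -> field01 c V L ->
  exists2 W : 'rV[R]_m -> 'rV[R[i]]_m',
    (\forall y \near c p, T01 c' (f (cinv c y)) (W y)) &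
    is_little_o (fun y => cpush (local_rep c c' f) y (L y) - W y)
      (c p) (r%:Z - 1).

(* "k' sufficiently large" is read as: for arbitrarily large orders k' allowed
   by the smoothness class of M'. *)
Definition nondeg_jet (l : nat) (j : jet) : Prop :=
  let p := j.1 in
  exists2 f, j.2 f &
  forall c c', chart_at p c -> chart_at (f p) c' ->
  forall k', smooth_ge kappa k' ->
  exists phi rho V (L : 'I_n -> vfield m),
    [/\ approx_embedding k' c' (f p) phi rho, coord_nbhd c p V, basis01 c V L &
      lspan [set w | exists (i : 'I_d') (a : {ffun 'I_n -> 'I_l.+1}),
        a \in mindices n l /\
        w = mpower (fun b => vact (L b)) (fun b => a b)
              (fun y => rhoZ rho i (phi (local_rep c c' f y))) (c p)]
      = setT].

Definition Djet (r l : nat) (j : jet) : Prop :=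
  is_jet r j /\
  (~ CR_jet r j \/
   (CR_jet r j /\ exists2 l0, (l0 <= l)%N & nondeg_jet l0 j)).

Definition is_section (r l : nat) (Phi : {j : jet | Djet r l j} -> jet) : Prop :=
  forall j, exists x f,
    [/\ smooth_near (FinSmooth r.+1) x f,
        Phi j = jet_of r.+1 x f & sval j = jet_of r x f].

(* In the coordinates (c x, jet_coord) of the jet bundles, Phi is near every
   point of D^{r,l} given by a C^s map G. *)
Definition smooth_section (s : smoothness) (r l : nat)
    (Phi : {j : jet | Djet r l j} -> jet) : Prop :=
  forall (j0 : {j : jet | Djet r l j}) f0 c c',
    (sval j0).2 f0 -> chart_at (sval j0).1 c -> chart_at (f0 (sval j0).1) c' ->
  exists (W : set ('rV[R]_m * 'M[R]_(#|mindices m r|, m'))%type)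
         (G : 'rV[R]_m * 'M[R]_(#|mindices m r|, m') ->
              'M[R]_(#|mindices m r.+1|, m')),
    [/\ open W,
        W (c (sval j0).1, jet_coord r c c' (sval j0).1 f0),
        Csmooth s W G &
        forall (j : {j : jet | Djet r l j}) f g,
          let x := (sval j).1 in
          (sval j).2 f -> (Phi j).2 g -> cdom c x -> cdom c' (f x) ->
          W (c x, jet_coord r c c' x f) ->
          jet_coord r.+1 c c' x g = G (c x, jet_coord r c c' x f)].

(* As Phi is only defined on D^{r,l}, the equation j^{r+1}_x f = Phi(x, j^r_x f)
   includes that its right-hand side is defined. *)
Definition satisfies (r l : nat) (Phi : {j : jet | Djet r l j} -> jet)
    U f : Prop :=
  forall x, U x ->
    exists h : Djet r l (jet_of r x f),
      jet_of r.+1 x f = Phi (exist _ (jet_of r x f) h).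

End Maps.
End CR.

(* Main.v *)
Require Import Defs.
From HB Require Import structures.
From mathcomp Require Import all_boot all_order all_algebra complex.
From mathcomp Require Import all_classical all_reals all_analysis.
From mathcomp Require Import ring lra zify.
Set Implicit Arguments.
Unset Strict Implicit.
Unset Printing Implicit Defensive.
Import Order.TTheory GRing.Theory Num.Theory numFieldNormedType.Exports.
Local Open Scope classical_set_scope.
Local Open Scope ring_scope.

(** In local charts the hypothesis on Phi says that the coordinate expression F
   of f solves a complete differential equation
     j^(r+1) F (y) = G (y, j^r F (y)),
   where G is of class C^s, s = kappa - k - 1.  Such an equation regularizes:
   if F is of class C^(r+1+t) with t < s, then y |-> (y, j^r F (y)) is of class
   C^(t+1), hence so is the right-hand side; thus all partial derivatives of F
   of order r+1 are of class C^(t+1), and F is of class C^(r+1+(t+1)).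
   Starting from F in C^(r+1) one reaches C^(r+1+s), which is more than C^s
   ([jet_equation_regularity], [satisfies_smooth]).

   Three points need care.  First, the classes C^t are defined by iterated
   directional derivatives, so their stability under linear maps, products and
   composition has to be established.  Second, a jet records each mixed partial
   derivative in one order of differentiation only, whereas the class C^(r+1+t)
   involves all orders; the symmetry of second derivatives ([derive_sym])
   bridges the gap ([wderiv_perm]).  Third, the induction has to start, that is,
   r + 1 <= k is needed.  This follows from the formulas for r and k as soon as
   d > 0; and d = 0 is impossible, because then T^cM = TM and M would be of
   type 1 < nu ([cr_type_codim_gt0]). *)

(** * Calculus of the classes C^s *)

Section CnTheory.
Context {R : realType}.
Implicit Types U V W : normedModType R.

(** The difference of F and G vanishes near x, so that the zero map is its
   differential there. *)
Lemma near_eq_differentiable V W (F G : V -> W) x :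
  (\forall y \near x, F y = G y) -> differentiable F x -> differentiable G x.
Proof.
move=> FG dF.
pose H := G - F.
have H0 : \forall y \near x, H y = 0.
  by apply: filterS FG => y E; rewrite /H !fctE E subrr.
have dH : H \o shift x = cst (H x) + (\0 : V -> W) +o_ 0 id.
  apply/eqaddoP => e e0.
  move: (H0) => /nbhs0P; apply: filterS => h Hh.
  rewrite -[X in `|X|]/(H (h + x) - (H x + 0)) [h + x]addrC Hh.
  rewrite (nbhs_singleton H0).
  by rewrite !addr0 subrr normr0 mulr_ge0 // ltW.
have -> : G = F + H by rewrite /H addrC subrK.
apply: differentiableD => //.
have E : 'd H x = \0 :> (V -> W).
  by apply: diff_unique dH => // y; apply: cst_continuous.
by apply/diff_locallyP; rewrite E; split => // y; apply: cst_continuous.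
Qed.

Lemma Cn_sub V W s (A B : set V) (F : V -> W) :
  A `<=` B -> Cn s B F -> Cn s A F.
Proof.
move=> AB; elim: s F => [|s IH] F /=; first by move=> H x /AB/H.
by move=> [dF cF]; split=> [x /AB/dF//|v]; apply/IH/cF.
Qed.

(** The derivatives of F are taken as a globally defined map, so that being C^s
   on a set is a property of the individual points of the set. *)
Lemma Cn_pointwise V W s (A : set V) (F : V -> W) :
  (forall x, A x -> exists2 B : set V, B x & Cn s B F) -> Cn s A F.
Proof.
move=> H; have {}H x : A x -> Cn s [set x] F.
  by move=> /H[B Bx]; apply: Cn_sub => _ ->.
elim: s F H => [|s IH] F H /=; first by move=> x Ax; apply: (H x Ax).
split=> [x Ax|v]; first by have [+ _] := H x Ax; apply.
by apply: IH => x Ax; have [_] := H x Ax; apply.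
Qed.

Lemma Cn_congr V W s (A : set V) (F G : V -> W) :
  open A -> {in A, F =1 G} -> Cn s A F -> Cn s A G.
Proof.
move=> oA; elim: s F G => [|s IH] F G FG /=.
  move=> cF x Ax; have FGx : \forall y \near x, F y = G y.
    near=> y; rewrite FG// inE; near: y; exact: open_nbhs_nbhs.
  rewrite /prop_for /continuous_at -(nbhs_singleton FGx).
  by apply: cvg_trans (cF x Ax); apply: near_eq_cvg.
have FGn x : A x -> \forall y \near x, F y = G y.
  move=> Ax; near=> y; rewrite FG// inE; near: y; exact: open_nbhs_nbhs.
move=> [dF cF]; split=> [x Ax|v].
  exact: near_eq_differentiable (FGn x Ax) (dF x Ax).
by apply: (IH ('D_v F)) => [x|//]; rewrite inE => /FGn; exact: near_eq_derive.
Unshelve. all: by end_near. Qed.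

Lemma CnW V W s (A : set V) (F : V -> W) : Cn s.+1 A F -> Cn s A F.
Proof.
elim: s F => [|s IH] F [dF cF].
  by move=> x /dF; exact: differentiable_continuous.
by split=> // v; apply/IH/cF.
Qed.

Lemma Cn_le V W s t (A : set V) (F : V -> W) :
  (t <= s)%N -> Cn s A F -> Cn t A F.
Proof.
move=> /subnK <-; elim: (s - t)%N => // q IH; rewrite addSn => /CnW; exact: IH.
Qed.

Lemma Cn_cst V W s (A : set V) (w : W) : Cn s A (fun _ : V => w).
Proof.
elim: s w => [|s IH] w /=; first by move=> x _; apply: cst_continuous.
split=> [x _|v]; first exact: differentiable_cst.
by under eq_fun do rewrite derive_cst.
Qed.

Lemma Cn_id V s (A : set V) : Cn s A (fun x : V => x).
Proof.
case: s => [|s] /=; first by move=> x _; exact: cvg_id.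
split=> [x _|v]; first exact: ex_diff.
by under eq_fun do rewrite derive_id; exact: Cn_cst.
Qed.

Lemma CnD V W s (A : set V) (F G : V -> W) : open A ->
  Cn s A F -> Cn s A G -> Cn s A (fun x => F x + G x).
Proof.
move=> oA; elim: s F G => [|s IH] F G /=.
  by move=> cF cG x Ax; apply: continuousD; [apply: cF|apply: cG].
move=> [dF cF] [dG cG]; split=> [x Ax|v].
  by apply: differentiableD; [apply: dF|apply: dG].
apply: (Cn_congr oA (F := fun x => 'D_v F x + 'D_v G x)); last exact: IH.
by move=> x; rewrite inE => Ax; rewrite deriveD//; apply: diff_derivable;
  [apply: dF|apply: dG].
Qed.

Lemma Cn_sum V W s (A : set V) (I : Type) (r : seq I) (F : I -> V -> W) :
  open A -> (forall i, Cn s A (F i)) -> Cn s A (fun x => \sum_(i <- r) F i x).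
Proof.
move=> oA cF; elim: r => [|i r IH].
  by under eq_fun do rewrite big_nil; exact: Cn_cst.
by under eq_fun do rewrite big_cons; exact: CnD.
Qed.

Lemma CnM V s (A : set V) (F G : V -> R) : open A ->
  Cn s A F -> Cn s A G -> Cn s A (fun x => F x * G x).
Proof.
move=> oA; elim: s F G => [|s IH] F G.
  by move=> cF cG x Ax; apply: continuousM; [apply: cF|apply: cG].
move=> cF1 cG1; have [cF0 cG0] := (CnW cF1, CnW cG1).
move: cF1 cG1 => [dF cF] [dG cG]; split=> [x Ax|v].
  by apply: differentiableM; [apply: dF|apply: dG].
apply: (Cn_congr oA (F := fun x => F x * 'D_v G x + G x * 'D_v F x)).
  by move=> x; rewrite inE => Ax; rewrite (@deriveM _ _ F G)//;
    apply: diff_derivable; [apply: dF|apply: dG].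
by apply: CnD => //; apply: IH => //; [exact: cG|exact: cF].
Qed.

Lemma Cn_linear U V W s (A : set U) (F : U -> V) (L : {linear V -> W}) :
  open A -> continuous L -> Cn s A F -> Cn s A (fun x => L (F x)).
Proof.
move=> oA cL; elim: s F => [|s IH] F /=.
  by move=> cF x Ax; apply: continuous_comp; [apply: cF|apply: cL].
move=> [dF cF]; split=> [x Ax|v].
  by apply: differentiable_comp; [apply: dF|apply: linear_differentiable].
apply: (Cn_congr oA (F := fun x => L ('D_v F x))); last exact: IH.
move=> x; rewrite inE => Ax; have dLF : differentiable (L \o F) x.
  by apply: differentiable_comp; [apply: dF|apply: linear_differentiable].
rewrite [RHS]deriveE// diff_comp ?deriveE//=; last exact: linear_differentiable.
- by rewrite diff_lin.
- exact: dF.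
- exact: dF.
Qed.

(** The family e with its coordinate functionals phi witnesses that V is
   finite-dimensional.  This is what makes the chain rule
   D_v (G o F) = dG (D_v F) amenable to induction on s: it becomes a finite sum
   of products of C^s functions, the partial derivatives D_(e i) G being
   composed with F again. *)
Lemma Cn_comp U V s (A : set U) (B : set V) (I : finType)
    (e : I -> V) (phi : I -> {linear V -> R}) (F : U -> V) (G : V -> R) :
  open A -> (forall x, A x -> B (F x)) ->
  (forall i, continuous (phi i)) -> (forall v, v = \sum_i phi i v *: e i) ->
  Cn s A F -> Cn s B G -> Cn s A (fun x => G (F x)).
Proof.
move=> oA AB cphi basis; elim: s G => [|s IH] G.
  by move=> cF cG x Ax; apply: continuous_comp; [apply: cF|apply/cG/AB].
move=> cF1 [dG cG]; have cF0 := CnW cF1; move: cF1 => [dF cF].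
split=> [x Ax|v].
  by apply: differentiable_comp; [apply: dF|apply/dG/AB].
apply: (Cn_congr oA
  (F := fun x => \sum_i phi i ('D_v F x) * 'D_(e i) G (F x))).
  move=> x; rewrite inE => Ax; have [dFx dGx] := (dF x Ax, dG _ (AB x Ax)).
  have dGF : differentiable (G \o F) x by apply: differentiable_comp.
  rewrite [RHS]deriveE// diff_comp//= -(deriveE _ dFx).
  rewrite [in RHS](basis ('D_v F x)) linear_sum; apply: eq_bigr => i _.
  by rewrite linearZ /= -deriveE.
apply: Cn_sum => // i; apply: CnM => //.
  by apply: Cn_linear => //; exact: cF.
by apply: (IH ('D_(e i) G)) => //; exact: cG.
Qed.

Lemma Cn_scalel V W s (A : set V) (F : V -> R) (w : W) :
  open A -> Cn s A F -> Cn s A (fun x => F x *: w).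
Proof.
move=> oA; have lin : linear (fun k : R => k *: w).
  by move=> a u v; rewrite scalerDl -scalerA.
pose linM := GRing.isLinear.Build _ _ _ _ _ lin.
pose L : {linear R -> W} := HB.pack (fun k : R => k *: w) linM.
by apply: (@Cn_linear _ _ _ _ _ _ L) => //; exact: scalel_continuous.
Qed.

Lemma Cn_continuous V W (F : V -> W) : Cn 0 setT F -> continuous F.
Proof. by move=> cF x; apply: cF. Qed.

Definition mxcoord p q (i : 'I_p) (j : 'I_q) (N : 'M[R]_(p, q)) : R := N i j.

Lemma mxcoord_linear p q i j : linear (@mxcoord p q i j).
Proof. by move=> a u v; rewrite /mxcoord !mxE. Qed.

HB.instance Definition _ p q i j :=
  GRing.isLinear.Build R 'M[R]_(p, q) R _ (@mxcoord p q i j)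
    (@mxcoord_linear p q i j).

Lemma Cn_coord V p q s (A : set V) (F : V -> 'M[R]_(p, q)) i j :
  open A -> Cn s A F -> Cn s A (fun x => F x i j).
Proof.
move=> oA; apply: (Cn_linear (L := mxcoord i j)) => //.
exact: coord_continuous.
Qed.

Lemma Cn_mx V p q s (A : set V) (F : V -> 'M[R]_(p, q)) :
  open A -> (forall i j, Cn s A (fun x => F x i j)) -> Cn s A F.
Proof.
move=> oA cF.
rewrite (_ : F = fun x => \sum_i \sum_j F x i j *: delta_mx i j).
  by do 2 (apply: Cn_sum => // ?); apply: Cn_scalel.
by apply/funext => x; rewrite -matrix_sum_delta.
Qed.

Lemma mx_linear_continuous W p q (L : {linear 'M[R]_(p, q) -> W}) :
  continuous L.
Proof.
apply: Cn_continuous.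
apply: (Cn_congr openT
  (F := fun N : 'M[R]_(p, q) => \sum_i \sum_j N i j *: L (delta_mx i j))).
  move=> N _; rewrite [in RHS](matrix_sum_delta N) linear_sum.
  by do 2 (apply: eq_bigr => ? _; rewrite ?linear_sum ?linearZ).
do 2 (apply: Cn_sum => [|?]; first exact: openT).
apply: Cn_scalel; first exact: openT.
apply: Cn_coord; first exact: openT.
exact: Cn_id.
Qed.

Lemma Cn_pair U V W s (A : set U) (F : U -> V) (G : U -> W) :
  open A -> Cn s A F -> Cn s A G -> Cn s A (fun x => (F x, G x)).
Proof.
move=> oA; elim: s F G => [|s IH] F G /=.
  by move=> cF cG x Ax; apply: cvg_pair; [apply: cF|apply: cG].
move=> [dF cF] [dG cG]; split=> [x Ax|v].
  by apply: differentiable_pair; [apply: dF|apply: dG].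
apply: (Cn_congr oA (F := fun x => ('D_v F x, 'D_v G x))); last exact: IH.
move=> x; rewrite inE => Ax; have [dFx dGx] := (dF x Ax, dG x Ax).
rewrite [RHS]deriveE ?diff_pair ?deriveE//.
exact: differentiable_pair.
Qed.

(** The case of composition that matters for a map G defined on a space of
   jets: points paired with the matrix of their partial derivatives. *)
Lemma Cn_comp_pair_mx U m p q p' q' s (A : set U)
    (B : set ('rV[R]_m * 'M[R]_(p, q))%type)
    (F : U -> 'rV[R]_m * 'M[R]_(p, q))
    (G : 'rV[R]_m * 'M[R]_(p, q) -> 'M[R]_(p', q')) :
  open A -> open B -> (forall x, A x -> B (F x)) ->
  Cn s A F -> Cn s B G -> Cn s A (fun x => G (F x)).
Proof.
move=> oA oB AB cF cG; apply: Cn_mx => // i j.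
pose e (a : 'I_m + 'I_p * 'I_q) : 'rV[R]_m * 'M[R]_(p, q) :=
  match a with
  | inl b => (delta_mx 0 b, 0)
  | inr b => (0, delta_mx b.1 b.2)
  end.
pose phi (a : 'I_m + 'I_p * 'I_q) :
    {linear ('rV[R]_m * 'M[R]_(p, q))%type -> R} :=
  match a with
  | inl b => mxcoord 0 b \o fst
  | inr b => mxcoord b.1 b.2 \o snd
  end.
apply: (Cn_comp oA AB (e := e) (phi := phi) (G := fun z => G z i j)) => //.
- case=> b z; apply: continuous_comp; try exact: coord_continuous.
  + exact: cvg_fst.
  + exact: cvg_snd.
- move=> [u v]; rewrite big_sumType /=.
  rewrite [X in _ = X + _](_ : _ = (u, 0)); last first.
    apply: injective_projections.
      rewrite (raddf_sum fst) [RHS]/= [RHS](row_sum_delta u).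
      by apply: eq_bigr.
    by rewrite (raddf_sum snd) big1// => b _ /=; rewrite scaler0.
  rewrite [X in _ = _ + X](_ : _ = (0, v)); last first.
    apply: injective_projections.
      by rewrite (raddf_sum fst) big1// => b _ /=; rewrite scaler0.
    rewrite (raddf_sum snd) [RHS]/= [RHS]matrix_sum_delta pair_big.
    by apply: eq_bigr.
  by congr pair; rewrite ?add0r ?addr0.
- exact: Cn_coord.
Qed.

(** * Symmetry of second derivatives *)

Lemma is_derive_line V (f : V -> R) (p u : V) (s : R) :
  differentiable f (p + s *: u) ->
  is_derive s 1 (fun t : R => f (p + t *: u)) ('D_u f (p + s *: u)).
Proof.
(* Both difference quotients are the same function of the increment. *)
have E : (fun h : R => h^-1 *: (f (p + (h *: 1 + s) *: u) - f (p + s *: u)))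
  = (fun h => h^-1 *: (f (h *: u + (p + s *: u)) - f (p + s *: u))).
  apply/funext => h; rewrite [h *: 1]mulr1 scalerDl.
  by rewrite addrCA.
move=> df; have dfu := @diff_derivable _ _ _ f _ u df; apply: DeriveDef.
  by move: dfu; rewrite /derivable /= -E.
by rewrite /derive /= -E.
Qed.

(** The second difference over the parallelogram spanned by h u and h v, by two
   applications of the mean value theorem: in the direction u to the increment
   of f along h v, then in the direction v to D_u f. *)
Lemma second_difference_mean V (A : set V) (f : V -> R) (p u v : V) (h : R) :
  Cn 2 A f -> 0 < h ->
  (forall s t, 0 <= s <= h -> 0 <= t <= h -> A (p + s *: u + t *: v)) ->
  exists s t, [/\ 0 <= s <= h, 0 <= t <= h &
    f (p + h *: u + h *: v) - f (p + h *: u) - (f (p + h *: v) - f p)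
    = 'D_v ('D_u f) (p + s *: u + t *: v) * h * h].
Proof.
move=> [df cDf] h0 Ap; have [dDuf _] := cDf u.
pose g s := f ((p + h *: v) + s *: u) - f (p + s *: u).
pose dg s := 'D_u f ((p + h *: v) + s *: u) - 'D_u f (p + s *: u).
have hh : 0 <= h <= h by rewrite lexx ltW.
have h00 : 0 <= (0 : R) <= h by rewrite lexx ltW.
have Au s : 0 <= s <= h -> A (p + s *: u).
  by move=> hs; have := Ap s 0 hs h00; rewrite scale0r addr0.
have Avu s : 0 <= s <= h -> A (p + h *: v + s *: u).
  by move=> hs; have := Ap s h hs hh; rewrite addrAC.
have gd s : 0 <= s <= h -> is_derive s 1 g (dg s).
  move=> hs; apply: is_deriveB; apply: is_derive_line; apply: df.
    exact: Avu.
  exact: Au.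
have [||s sh Eg] := @MVT R g dg 0 h h0.
- by move=> s; rewrite in_itv /= => /andP[s0 sh]; apply: gd; rewrite !ltW.
- apply: derivable_within_continuous => s; rewrite in_itv /= => hs.
  by have := gd s hs; case.
have {}sh : 0 <= s <= h.
  by move: sh; rewrite in_itv /= => /andP[s0 sh]; rewrite !ltW.
pose k t := 'D_u f (p + s *: u + t *: v).
have kd t : 0 <= t <= h ->
    is_derive t 1 k ('D_v ('D_u f) (p + s *: u + t *: v)).
  by move=> ht; apply: is_derive_line; apply/dDuf/Ap.
have [||t th Ek] :=
  @MVT R k (fun t => 'D_v ('D_u f) (p + s *: u + t *: v)) 0 h h0.
- by move=> t; rewrite in_itv /= => /andP[t0 th]; apply: kd; rewrite !ltW.
- apply: derivable_within_continuous => t; rewrite in_itv /= => ht.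
  by have := kd t ht; case.
have {}th : 0 <= t <= h.
  by move: th; rewrite in_itv /= => /andP[t0 th]; rewrite !ltW.
exists s, t; split=> //.
move: Eg Ek; rewrite /g /dg /k !subr0 !scale0r !addr0 => Eg Ek.
by rewrite -Ek [p + s *: u + _]addrAC -Eg [p + h *: u + _]addrAC.
Qed.

Lemma dist_lt_split (a b c e : R) :
  `|a - c| < e / 2 -> `|b - c| < e / 2 -> `|a - b| < e.
Proof.
move=> ac bc; have := ler_normB (a - c) (b - c).
by rewrite (_ : a - c - (b - c) = a - b); [lra|ring].
Qed.

(** The second difference is symmetric in u and v, so that by
   [second_difference_mean] both D_v D_u f and D_u D_v f take a same value at
   points arbitrarily close to x; conclude by continuity. *)
Lemma derive_sym V (A : set V) (f : V -> R) (u v x : V) :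
  open A -> Cn 2 A f -> A x -> 'D_v ('D_u f) x = 'D_u ('D_v f) x :> R.
Proof.
move=> oA cf Ax.
have [_ cDf] := cf; have [_ /(_ v) cvu] := cDf u; have [_ /(_ u) cuv] := cDf v.
apply/eqP; rewrite -subr_eq0 -normr_eq0 eq_le normr_ge0 andbT.
apply/ler_addgt0Pl => e e0; rewrite addr0.
pose P y := [/\ A y, `| 'D_v ('D_u f) x - 'D_v ('D_u f) y| < e / 2
             & `| 'D_u ('D_v f) x - 'D_u ('D_v f) y| < e / 2].
have e20 : 0 < e / 2 by rewrite divr_gt0.
have : \forall y \near x, P y.
  have near_A : nbhs x A by exact: open_nbhs_nbhs.
  have near_vu : \forall y \near x,
      `| 'D_v ('D_u f) x - 'D_v ('D_u f) y| < e / 2.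
    by have /cvgrPdist_lt := cvu x Ax; apply.
  have near_uv : \forall y \near x,
      `| 'D_u ('D_v f) x - 'D_u ('D_v f) y| < e / 2.
    by have /cvgrPdist_lt := cuv x Ax; apply.
  apply: (filterS _ (filterI near_A (filterI near_vu near_uv))).
  by move=> y [Ay [yvu yuv]]; split.
move=> /nbhs_ballP[d /= d0 Pd].
pose N := `|u| + `|v| + 1; pose h := d / 2 / N.
have N0 : 0 < N by rewrite ltr_wpDl// addr_ge0.
have h0 : 0 < h by rewrite !divr_gt0.
have Ph s t : 0 <= s <= h -> 0 <= t <= h -> P (x + s *: u + t *: v).
  move=> /andP[s0 sh] /andP[t0 th]; apply: Pd.
  rewrite -ball_normE /ball_ /= -addrA opprD addrA subrr add0r normrN.
  rewrite (le_lt_trans (ler_normD _ _))// !normrZ !ger0_norm//.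
  have : s * `|u| + t * `|v| <= h * N.
    rewrite /N !mulrDr mulr1 -[leLHS]addr0; apply: lerD; last exact: ltW.
    by apply: lerD; apply: ler_wpM2r.
  move=> /le_lt_trans; apply; rewrite /h divfK ?gt_eqF//.
  by rewrite ltr_pdivrMr// ltr_pMr// ltr1n.
have cancel (a b X Y : R) : X = a * h * h -> Y = b * h * h -> X = Y -> a = b.
  by move=> -> -> E; do 2 apply: (mulIf (lt0r_neq0 h0)).
have [|s [t [hs ht E1]]] :=
  second_difference_mean (u := u) (v := v) (p := x) cf h0.
  by move=> s t hs ht; case: (Ph s t hs ht).
have [|t' [s' [ht' hs' E2]]] :=
  second_difference_mean (u := v) (v := u) (p := x) cf h0.
  by move=> t' s' ht' hs'; rewrite addrAC; case: (Ph s' t' hs' ht').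
have E : 'D_v ('D_u f) (x + s *: u + t *: v)
       = 'D_u ('D_v f) (x + t' *: v + s' *: u).
  by apply: cancel E1 E2 _; rewrite [x + h *: v + _]addrAC; ring.
have [_ + _] := Ph s t hs ht; rewrite E addrAC => H1.
have [_ _ H2] := Ph s' t' hs' ht'.
exact: ltW (dist_lt_split H1 H2).
Qed.

End CnTheory.

(** * Iterated partial derivatives *)

Section Words.
Context {R : realType} {m q : nat}.
Implicit Types (A : set 'rV[R]_m) (F G : 'rV[R]_m -> 'rV[R]_q) (w : seq 'I_m).

Lemma derive_sym_rV A F (u v : 'rV[R]_m) :
  open A -> Cn 2 A F -> {in A, 'D_v ('D_u F) =1 'D_u ('D_v F)}.
Proof.
move=> oA cF x; rewrite inE => Ax.
have coordD (H : 'rV[R]_m -> 'rV[R]_q) z y j : differentiable H y ->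
    'D_z H y 0 j = 'D_z (fun y => H y 0 j) y.
  by move=> dH; rewrite derive_mx ?mxE//; apply: diff_derivable.
have coordDD z z' j : 'D_z' ('D_z F) x 0 j = 'D_z' ('D_z (fun y => F y 0 j)) x.
  have [dF /(_ z)[dDF _]] := cF.
  rewrite coordD; last exact: dDF.
  apply: near_eq_derive; near=> y; rewrite coordD//; apply: dF.
  by near: y; exact: open_nbhs_nbhs.
apply/rowP => j; have E := derive_sym u v oA (Cn_coord 0 j oA cF) Ax.
apply: (etrans (coordDD u v j)); apply: etrans _ (esym (coordDD v u j)).
exact E.
Unshelve. all: by end_near. Qed.

(** The word w lists the coordinates of differentiation, its first letter being
   applied last.  Unlike a multi-index it keeps track of the order, as the
   definition of the classes C^s does. *)
Definition wderiv w F := foldr (@pderiv R m q) F w.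

Lemma wderiv_cat w1 w2 F : wderiv (w1 ++ w2) F = wderiv w1 (wderiv w2 F).
Proof. by rewrite /wderiv foldr_cat. Qed.

Lemma pderiv_congr A F G i : open A ->
  {in A, F =1 G} -> {in A, pderiv i F =1 pderiv i G}.
Proof.
move=> oA FG x; rewrite inE => Ax; apply: near_eq_derive; near=> y.
by rewrite FG// inE; near: y; exact: open_nbhs_nbhs.
Unshelve. all: by end_near. Qed.

Lemma Cn_wderiv A F w t : Cn (size w + t) A F -> Cn t A (wderiv w F).
Proof.
elim: w t => [//|i w IH] t; rewrite [size _]/= addSnnS => /IH[_]; exact.
Qed.

Lemma wderiv_move A F w1 w2 i : open A ->
  Cn (size w1 + size w2).+1 A F ->
  {in A, wderiv (w1 ++ i :: w2) F =1 wderiv (i :: w1 ++ w2) F}.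
Proof.
move=> oA; elim: w1 => [//|j w1 IH] cF x Ax.
have c2F : Cn 2 A (wderiv (w1 ++ w2) F).
  by apply: Cn_wderiv; apply: Cn_le cF; rewrite size_cat /=; lia.
apply: (etrans (pderiv_congr j oA (IH (CnW cF)) Ax)).
exact (derive_sym_rV _ _ oA c2F Ax).
Qed.

Lemma wderiv_perm A F w w' : open A -> perm_eq w w' ->
  Cn (size w) A F -> {in A, wderiv w F =1 wderiv w' F}.
Proof.
move=> oA; elim: w w' => [|i w IH] w' ww' cF x Ax.
  by move: ww'; rewrite perm_sym => /perm_nilP->.
have : i \in w' by rewrite -(perm_mem ww') mem_head.
move=> /splitPr ww; case: ww ww' => w1 w2.
rewrite perm_sym perm_catC /= perm_cons perm_catC perm_sym => ww'.
have sF : Cn (size w1 + size w2).+1 A F.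
  by rewrite -size_cat -(perm_size ww').
apply: (etrans (pderiv_congr i oA (IH _ ww' (CnW cF)) Ax)).
exact (esym (wderiv_move i oA sF Ax)).
Qed.

Lemma derive_pderiv F x v :
  differentiable F x -> 'D_v F x = \sum_i v 0 i *: pderiv i F x.
Proof.
move=> dF; rewrite deriveE// {1}(row_sum_delta v) linear_sum.
by apply: eq_bigr => i _; rewrite linearZ /= /pderiv deriveE.
Qed.

(** A map that is already C^s gains t derivatives once its derivatives of order
   exactly s are C^t: the directional derivatives in the definition of C^s are
   combinations of partial ones by [derive_pderiv]. *)
Lemma Cn_wderivP A F s t : open A -> Cn s A F ->
  (forall w, size w = s -> Cn t A (wderiv w F)) -> Cn (s + t) A F.
Proof.
move=> oA; elim: s F => [|s IH] F; first by move=> _ /(_ [::] erefl).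
move=> [dF cF] cwF; rewrite addSn; split=> // v.
apply: (Cn_congr oA (F := fun x => \sum_i v 0 i *: pderiv i F x)).
  by move=> x; rewrite inE => Ax; rewrite derive_pderiv//; apply: dF.
apply: Cn_sum => // i.
apply: (Cn_linear (L := *:%R (v 0 i))) => //; first exact: scaler_continuous.
apply: IH => [|w sw]; first exact: cF.
by have := cwF (w ++ [:: i]); rewrite size_cat sw addn1 wderiv_cat; apply.
Qed.

Lemma mpower_wderiv (a : 'I_m -> nat) F :
  mpower (@pderiv R m q) a F
  = wderiv (flatten [seq nseq (a i) i | i <- enum 'I_m]) F.
Proof.
rewrite /mpower; elim: (enum 'I_m) => [//|i s IH] /=.
by rewrite IH wderiv_cat /wderiv; elim: (a i) => [//|n /= ->].
Qed.

Lemma Cn_taylor A F r t : open A -> Cn (r + t) A F -> Cn t A (taylor r F).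
Proof.
move=> oA cF; apply: Cn_mx => // i j.
rewrite (_ : (fun x => _) = fun x =>
  mpower (@pderiv R m q) (fun b => enum_val i b : nat) F x 0 j); last first.
  by apply/funext => x; rewrite mxE.
apply: Cn_coord => //; rewrite mpower_wderiv; apply: Cn_wderiv.
apply: Cn_le cF; rewrite leq_add2r size_flatten /shape -map_comp.
have := enum_valP i; rewrite inE => /(leq_trans _); apply.
rewrite sumnE big_map big_enum /=; apply: eq_leq; apply: eq_bigr => b _.
by rewrite /= size_nseq.
Qed.

(** The row is that of the multi-index counting the letters of w; its word is
   the sorted rearrangement of w. *)
Lemma taylor_wderiv A F r w : open A -> (size w <= r)%N -> Cn (size w) A F ->
  exists i, {in A, forall x, wderiv w F x = row i (taylor r F x)}.
Proof.
move=> oA wr cF.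
have cw b : (count_mem b w < r.+1)%N.
  by rewrite ltnS (leq_trans (count_size _ _)).
pose a : {ffun 'I_m -> 'I_r.+1} := [ffun b => Ordinal (cw b)].
have pw : perm_eq w (flatten [seq nseq (a i : nat) i | i <- enum 'I_m]).
  rewrite /perm_eq; apply/allP => b _ /=.
  rewrite count_flatten -map_comp sumnE big_map big_enum /= (bigD1 b)//= big1.
    by rewrite count_nseq /= eqxx mul1n addn0 ffunE.
  by move=> c cb; rewrite count_nseq /= (negbTE cb).
have am : a \in mindices m r.
  rewrite inE (leq_trans _ wr)// (perm_size pw) size_flatten /shape -map_comp.
  rewrite sumnE big_map big_enum /=; apply: eq_leq; apply: eq_bigr => b _.
  by rewrite /= size_nseq.
exists (enum_rank_in am a) => x Ax; rewrite rowK.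
by rewrite enum_rankK_in// mpower_wderiv (wderiv_perm oA pw).
Qed.

End Words.

(** * Complete equations for jets *)

Section Bootstrap.
Context {R : realType} {m q : nat}.

(** Induction on s: a solution of class C^(r+1+s) = C^(r+(s+1)) has an r-jet of
   class C^(s+1), hence by the equation an (r+1)-jet of that class as soon as G
   is C^(s+1). *)
Lemma jet_equation_regularity (A : set 'rV[R]_m) (F : 'rV[R]_m -> 'rV[R]_q)
    (r s : nat) (B : set ('rV[R]_m * 'M[R]_(#|mindices m r|, q))%type)
    (G : 'rV[R]_m * 'M[R]_(#|mindices m r|, q) ->
         'M[R]_(#|mindices m r.+1|, q)) :
  open A -> open B -> (forall y, A y -> B (y, taylor r F y)) -> Cn s B G ->
  (forall y, A y -> taylor r.+1 F y = G (y, taylor r F y)) ->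
  Cn r.+1 A F -> Cn (r.+1 + s) A F.
Proof.
move=> oA oB AB + jetF cF; elim: s => [|s IH] cG; first by rewrite addn0.
have {}IH := IH (CnW cG).
apply: Cn_wderivP => // w sw.
have cwF : Cn (size w) A F by rewrite sw.
have [i Ei] := taylor_wderiv oA (eq_leq sw) cwF.
apply: (Cn_congr oA (F := fun y => row i (G (y, taylor r F y)))).
  by move=> y Ay; rewrite Ei// jetF//; move: Ay; rewrite inE.
apply: (Cn_linear (L := row i)) => //; first exact: mx_linear_continuous.
apply: (Cn_comp_pair_mx oA oB AB _ cG); apply: Cn_pair => //.
  exact: Cn_id.
by apply: Cn_taylor => //; rewrite addnS -addSn.
Qed.

End Bootstrap.

(** * Charts and CR-codimension *)

Section Charts.
Context {R : realType}.

Lemma open_chart_image (M : topologicalType) m (c : chart R M m) (E : set M) :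
  is_chart c -> open E -> E `<=` cdom c -> open (c @` E).
Proof.
move=> [_ oc _ cinvc cK] oE Ec.
rewrite openE => _ [x Ex <-]; rewrite /interior.
have cx : (c @` cdom c) (c x) by exists x => //; apply: Ec.
have nE : nbhs (c x) (cinv c @^-1` E).
  by apply: (cinvc _ cx); rewrite cK; [exact: open_nbhs_nbhs|exact: Ec].
have nc : nbhs (c x) (c @` cdom c) by exact: open_nbhs_nbhs.
apply: (filterS _ (filterI nE nc)) => y [Ey [z cz zy]].
by exists z => //; move: Ey; rewrite /= -zy cK.
Qed.

Lemma Csmooth_linear (U V W : normedModType R) s (A : set U) (F : U -> V)
    (L : {linear V -> W}) :
  open A -> continuous L -> Csmooth s A F -> Csmooth s A (fun x => L (F x)).
Proof.
by move=> oA cL; case: s => [s|] /= cF; [|move=> t]; apply: Cn_linear.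
Qed.

Lemma reM_cplxM p q (X Y : 'M[R]_(p, q)) : reM (cplxM X Y) = X.
Proof. by apply/matrixP => i j; rewrite !mxE. Qed.

Lemma imM_cplxM p q (X Y : 'M[R]_(p, q)) : imM (cplxM X Y) = Y.
Proof. by apply/matrixP => i j; rewrite !mxE. Qed.

End Charts.

Section CRManifolds.
Local Open Scope complex_scope.
Context {R : realType} {kappa : smoothness}.

Lemma smooth_on_le n d n' d' (M : cr_manifold R kappa n d)
    (M' : cr_manifold R kappa n' d') U (f : M -> M') s t : (t <= s)%N ->
  smooth_on (FinSmooth s) U f -> smooth_on (FinSmooth t) U f.
Proof.
by move=> ts [cf sf]; split=> // c c' ac ac'; apply: Cn_le ts (sf c c' ac ac').
Qed.

(** With CR-codimension 0 the frame X of T^cM is a frame of TM.  So if a X is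
   the real part and b X the imaginary part of Z, then Z is a combination of the
   fields a X +- i (a X) J and b X +- i (b X) J, which are of types (0,1) and
   (1,0). *)
Lemma comm_span1_codim0 n (M : cr_manifold R kappa n 0) (x : M) : comm_span 1 x.
Proof.
move=> c cx; apply/seteqP; split=> // Z _.
have [V [X [cV cX cXJ freeX TX]]] := Tc_frame cx.
have [oV Vx _] := cV.
pose f01 (a : 'rV[R]_(2 * n)) y :=
  cplxM (a *m X y) (a *m (X y *m Jc c (cinv c y))).
pose f10 (a : 'rV[R]_(2 * n)) y :=
  cplxM (a *m X y) (- a *m (X y *m Jc c (cinv c y))).
have smooth a b : CsmoothC (smooth_sub kappa 1) V
    (fun y => cplxM (a *m X y) (b *m (X y *m Jc c (cinv c y)))).
  split.
    under eq_fun do rewrite reM_cplxM.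
    apply: (Csmooth_linear (L := mulmx a)) => //; exact: mx_linear_continuous.
  under eq_fun do rewrite imM_cplxM.
  apply: (Csmooth_linear (L := mulmx b)) => //; exact: mx_linear_continuous.
have F01 a : field01 c V (f01 a).
  split=> [|y Vy]; first exact: (smooth a a).
  exists (a *m X y); first by apply/(TX y Vy); exact: submxMl.
  by rewrite /f01 mulmxA.
have F10 a : field10 c V (f10 a).
  split=> [|y Vy]; first exact: (smooth a (- a)).
  exists (a *m X y); first by apply/(TX y Vy); exact: submxMl.
  by rewrite /f10 mulNmx mulmxA.
have fullX : row_full (X (c x)).
  by have /eqP := freeX _ Vx; rewrite /row_full => ->; rewrite addn0.
have /submxP[a Ea] : (reM Z <= X (c x))%MS by rewrite submx_full.
have /submxP[b Eb] : (imM Z <= X (c x))%MS by rewrite submx_full.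
(* Z = a X + i b X, with a X = 1/2 (f01 a + f10 a) and likewise for b. *)
pose h : R[i] := 2^-1 +i* 0; pose ih : R[i] := 0 +i* 2^-1.
exists 4%N, (fun i => nth 0 [:: h; h; ih; ih] i),
  (fun i => nth 0 [:: f01 a (c x); f10 a (c x); f01 b (c x); f10 b (c x)] i).
split.
  have mem L : field10 c V L \/ field01 c V L -> exists V a A,
      [/\ coord_nbhd c x V, (a <= 1)%N, commutator c V a A & L (c x) = A (c x)].
    by move=> FL; exists V, 1%N, L; split=> //; exact: Comm1.
  by case=> -[|[|[|[|//]]]] ?; apply: mem; auto.
rewrite !big_ord_recl big_ord0 /= addr0.
apply/rowP => j; move/rowP/(_ j): Ea; move/rowP/(_ j): Eb.
rewrite /f01 /f10 !mulNmx !mxE; case: (Z 0 j) => zr zi /= -> ->.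
by apply/eqP; rewrite eq_complex /=; apply/andP; split; apply/eqP; field.
Qed.

Lemma cr_type_codim_gt0 n d (M : cr_manifold R kappa n d) nu :
  (2 <= nu)%N -> cr_type M nu -> (0 < d)%N.
Proof.
case: d M => // M nu2 [_ [x [_ _ min]]]; exfalso.
by apply: (min 1%N); [lia|exact: comm_span1_codim0].
Qed.

(** * Regularity of the maps satisfying j^(r+1) f = Phi (j^r f) *)

(** The bound r < k makes f itself represent its r-jets and (r+1)-jets, so that
   the local expression G of Phi yields an equation for the partial derivatives
   of f in a single pair of charts. *)
Lemma satisfies_smooth n d n' d' (M : cr_manifold R kappa n d)
    (M' : cr_manifold R kappa n' d') (r l k : nat) (s : smoothness)
    (Phi : {j : jet M M' | Djet r l j} -> jet M M') (U : set M) (f : M -> M') :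
  (r < k)%N -> open U -> smooth_on (FinSmooth k) U f ->
  smooth_section s Phi -> satisfies Phi U f -> smooth_on s U f.
Proof.
move=> rk oU fk sPhi solf; have [cf sf] := fk.
split=> // c c' ac ac'; set E := U `&` cdom c `&` f @^-1` cdom c'.
have [odc _ _ _ _] := atlas_chart ac; have [odc' _ _ _ _] := atlas_chart ac'.
have oE : open E.
  rewrite openE => x [[Ux cx] c'fx]; rewrite /interior.
  have n1 : nbhs x U by exact: open_nbhs_nbhs.
  have n2 : nbhs x (cdom c) by exact: open_nbhs_nbhs.
  have n3 : nbhs x (f @^-1` cdom c').
    by apply: (cf x Ux); exact: open_nbhs_nbhs.
  exact: (filterI (filterI n1 n2) n3).
have oB : open (c @` E).
  by apply: open_chart_image => //; [exact: atlas_chart|move=> x [[]]].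
set F := local_rep c c' f.
have cF : Cn r.+1 (c @` E) F by apply: Cn_le rk (sf c c' ac ac').
suff loc x : E x -> exists2 A : set 'rV[R]_(2 * n + d),
    A (c x) & Csmooth s A F.
  case: (s) loc => [t|] /= loc; first by apply: Cn_pointwise => _ [x /loc ? <-].
  by move=> t; apply: Cn_pointwise => _ [x /loc[A Ax sA] <-]; exists A.
move=> Ex; have [[Ux cx] c'fx] := Ex.
have fx : smooth_near (FinSmooth r) x f.
  by exists U; split=> //; apply: smooth_on_le fk; exact: ltnW.
have [h Phix] := solf x Ux.
have [||//|W [G [oW Wx sG WG]]] := sPhi (exist _ (jet_of r x f) h) f c c'.
- by split.
- by split.
pose A := c @` E `&` [set y | W (y, taylor r F y)].
have oA : open A.
  have cjet : Cn 0 (c @` E) (fun y => (y, taylor r F y)).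
    apply: Cn_pair => //; first exact: Cn_id.
    by apply: Cn_taylor => //; apply: Cn_le cF; rewrite addn0.
  rewrite openE => y [Ey Wy]; rewrite /interior; apply: filterI.
    exact: open_nbhs_nbhs.
  by apply: (cjet y Ey); exact: open_nbhs_nbhs.
exists A; first by split; [exists x|].
have jetF y : A y -> taylor r.+1 F y = G (y, taylor r F y).
  move=> [[z Ez <-] /= Wz]; have [[Uz cz] c'fz] := Ez.
  have [hz Phiz] := solf z Uz.
  apply: (WG (exist _ (jet_of r z f) hz) f f) => //=.
    by split=> //; exists U; split=> //; apply: smooth_on_le fk; exact: ltnW.
  by rewrite -Phiz; split=> //; exists U; split=> //; apply: smooth_on_le fk.
have reg t : Cn t W G -> Cn t A F.
  move=> cG; apply: (@Cn_le _ _ _ (r.+1 + t)%N); first exact: leq_addl.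
  apply: (jet_equation_regularity oA oW _ cG jetF) => [y []//|].
  by apply: Cn_sub cF => y [].
by case: (s) sG => [t|] /= sG; [exact: reg|move=> t; exact: reg].
Qed.

End CRManifolds.

Theorem corollary2p3 (R : realType) (kappa : smoothness) (n d n' d' : nat)
    (M : cr_manifold R kappa n d) (M' : cr_manifold R kappa n' d')
    (nu l r k : nat)
    (hr : r = (2 * (d + 1) * l)%N)
    (hk : k = (4 * (d ^ 2 + d) * nu * l + 4 * (d ^ 2 - 1) * l
               + (2 * d * nu - 2 * d) + 1)%N)
    (hnu : (2 <= nu)%N) (hnukappa : smooth_ge kappa nu)
    (htype : cr_type M nu)
    (hkappa : smooth_ge kappa k.+1)
    (hPhi : exists Phi : {j : jet M M' | Djet r l j} -> jet M M',
       [/\ is_section Phi,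
           smooth_section (smooth_sub kappa k.+1) Phi &
           forall (U : set M) (l0 : nat) (f : M -> M'),
             open U -> (l0 <= l)%N ->
             smooth_on (FinSmooth k) U f -> CR_on U f ->
             nondegenerate_on k l0 U f ->
             satisfies Phi U f]) :
  (forall (U : set M) (f : M -> M'),
     open U -> smooth_on (FinSmooth k) U f -> CR_on U f ->
     nondegenerate_on k l U f ->
     smooth_on (smooth_sub kappa k.+1) U f) /\
  (kappa = InfSmooth ->
   forall (U : set M) (f : M -> M'),
     open U -> smooth_on (FinSmooth k) U f -> CR_on U f ->
     nondegenerate_on k l U f ->
     smooth_on InfSmooth U f).
Proof.
have d_gt0 := cr_type_codim_gt0 hnu htype.
(* k exceeds 4 (d^2 + d) nu l >= 8 (d + 1) l >= r. *)
have rk : (r < k)%N.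
  have dl : (d * l <= d ^ 2 * nu * l)%N.
    rewrite leq_mul2r -{1}[d]muln1 expnS expn1 -mulnA.
    by rewrite leq_mul2l; apply/orP; right; apply/orP; right; nia.
  have ll : (d * l <= d * nu * l)%N.
    by rewrite leq_mul2r; apply/orP; right; apply: leq_pmulr; lia.
  have l1 : (l <= d * l)%N by exact: leq_pmull.
  by rewrite hk hr; nia.
have [Phi [_ sPhi solPhi]] := hPhi.
have reg (U : set M) (f : M -> M') : open U -> smooth_on (FinSmooth k) U f ->
    CR_on U f -> nondegenerate_on k l U f ->
    smooth_on (smooth_sub kappa k.+1) U f.
  move=> oU fk fCR fl; apply: (satisfies_smooth rk oU fk sPhi).
  exact: (solPhi U l f oU (leqnn l) fk fCR fl).
split=> // kappaE U f oU fk fCR fl.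
by have := reg U f oU fk fCR fl; rewrite [X in smooth_sub X]kappaE.
Qed.
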